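(* Consider the Best-1 case of the Sliding-Window Secretary Problem with $N$ applicants and window size $K$, $1\le K\le N$, and let $d^*$ be the optimal threshold number of applicants to reject. (i) If $K>\frac N2$, then $d^*=0$. (ii) If $K=\frac N2$, then $d^*=0$ or $d^*=1$. (iii) For large $N$ and $K\ge \frac N2$, the optimal probability of winning satisfies $\Pr(\mathrm{Win})\approx 2-\frac KN+\ln\frac KN$; that is, for every sequence of integers $(K_N)_{N\ge1}$ with $\frac N2\le K_N\le N$, the optimal probability of winning $\Pr(\mathrm{Win})$ with $N$ applicants and window size $K_N$ satisfies $$\Pr(\mathrm{Win})-\left(2-\frac{K_N}{N}+\ln\frac{K_N}{N}\right)\to 0\quad\text{as } N\to\infty.$$
   Context: Setting (Best-1 case with window size $K$). There are $N$ applicants, seen in the order of their indices $1,\dots,N$. $R$ is a uniformly random permutation of $\{1,\dots,N\}$; $R(m)$ is the absolute rank of the applicant at index $m$, with $1$ the best rank. The interviewer observes only relative ranks of the applicants seen so far. When the window starts at index $i$, it consists of applicants $i,\dots,\min(i+K-1,N)$, and exactly the applicants $1,\dots,\min(i+K-1,N)$ have been seen. The interviewer may then choose any applicant in the window (ending the process) or reject applicant $i$ and move the window to start at $i+1$; rejected applicants cannot be recalled. One applicant can be chosen, and the interviewer wins iff that applicant has rank $1$. Under the sliding rule (advance the window until a candidate is at its smallest index), applicant $i$ is a candidate iff $R(i)=\min\{R(1),\dots,R(\min(i+K-1,N))\}$. The threshold strategy with threshold $d$ rejects the first $d$ applicants and chooses the first index $i>d$ such that applicant $i$ is a candidate. Optimal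 threshold: $d^*+1$ is the smallest index $i$ such that $\Pr(\mathrm{Win}\mid\text{Choosing Candidate } i)>\Pr(\mathrm{Win}\mid\text{Rejecting Candidate } i)$, where both probabilities are conditional on applicant $i$ being a candidate with the window starting at $i$, and after a rejection the interviewer continues optimally. The threshold strategy with threshold $d^*$ is the optimal strategy, and $\Pr(\mathrm{Win})$ denotes its probability of winning. *)

(* Defs.v *)
From HB Require Import structures.
From mathcomp Require Import all_boot all_order all_algebra all_fingroup.
From mathcomp Require Import all_classical all_reals all_analysis.

Set Implicit Arguments.
Unset Strict Implicit.
Unset Printing Implicit Defensive.

Import Order.TTheory GRing.Theory Num.Theory.
Import numFieldNormedType.Exports.

Local Open Scope ring_scope.

(** Applicants and absolute ranks are both numbered from 0 ([s i] is the rank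
    of applicant [i], and rank [0] is the best), so the index i and the rank r
    of a 1-based description appear here as i-1 and r-1.  In particular the
    window starting at [i] consists of the [j : 'I_N] with [i <= j < i + K], and
    the applicants seen by then are the [j : 'I_N] with [j < i + K]; the
    truncation at [N] is enforced by the type ['I_N]. *)

Section Probability.
Variables (R : realType) (N : nat).

Definition Pr (E : pred 'S_N) : R := #|E|%:R / #|{: 'S_N}|%:R.

Definition cPr (E F : pred 'S_N) : R := Pr [predI E & F] / Pr F.

End Probability.

Section SlidingWindow.
Variables (N K : nat).

Definition best (i : 'I_N) : pred 'S_N := [pred s : 'S_N | s i == 0 :> nat].

Definition candidate (i : 'I_N) : pred 'S_N :=
  [pred s : 'S_N | [forall j : 'I_N, (j < i + K)%N ==> (s i <= s j)%N]].

(** Relative rank, in [1 .. m], of applicant [j] among the first [m] ones. *)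
Definition rel_rank (m : nat) (s : 'S_N) (j : 'I_N) : nat :=
  #|[set k : 'I_N | (k < m)%N && (s k <= s j)%N]|.

Definition same_obs (m : nat) (s t : 'S_N) : bool :=
  [forall j : 'I_N, (j < m)%N ==> (rel_rank m s j == rel_rank m t j)].

(** [sigma i s] is the decision taken when the window starts at [i]:
    [Some j] chooses applicant [j], [None] rejects applicant [i] and slides. *)
Definition rule := {ffun 'I_N -> {ffun 'S_N -> option 'I_N}}.

Definition in_window (sigma : rule) : bool :=
  [forall i, forall s, forall j,
     (sigma i s == Some j) ==> (i <= j < i + K)%N].

Definition adapted (sigma : rule) : bool :=
  [forall i : 'I_N, forall s, forall t,
     same_obs (i + K) s t ==> (sigma i s == sigma i t)].

Definition strategy (sigma : rule) : bool := in_window sigma && adapted sigma.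

(** Applicant chosen when [sigma] is followed from the window starting at [i]
    on; [None] if all the remaining applicants are rejected. *)
Definition chosen (sigma : rule) (i : nat) (s : 'S_N) : option 'I_N :=
  ohead (pmap (fun k => sigma k s) [seq k : 'I_N <- enum 'I_N | (i <= k)%N]).

Definition wins_from (sigma : rule) (i : nat) : pred 'S_N :=
  [pred s | if chosen sigma i s is Some j then best j s else false].

Definition threshold_rule (d : nat) : rule :=
  [ffun i : 'I_N =>
    [ffun s : 'S_N => if (d <= i)%N && candidate i s then Some i else None]].

End SlidingWindow.

Section OptimalThreshold.
Variables (R : realType) (N K : nat).

Definition win_choosing (i : 'I_N) : R := cPr R (best i) (candidate K i).

(** The strategies form a finite nonempty set and the probabilities are
    nonnegative, so this is the maximum over all continuations from [i + 1]. *)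
Definition win_rejecting (i : 'I_N) : R :=
  \big[Num.max/0]_(sigma : rule N | strategy K sigma)
    cPr R (wins_from sigma i.+1) (candidate K i).

(** The 0-based position of the first index where choosing is strictly better
    is the number of applicants preceding it.  [find] succeeds when [0 < N],
    as choosing the last applicant, if it is a candidate, wins surely. *)
Definition opt_threshold : nat :=
  find (fun i : 'I_N => win_rejecting i < win_choosing i) (enum 'I_N).

Definition opt_win : R :=
  Pr R (wins_from (threshold_rule N K opt_threshold) 0).

End OptimalThreshold.

(* Main.v *)
Require Import Defs.
From HB Require Import structures.
From mathcomp Require Import all_boot all_order all_algebra all_fingroup.
From mathcomp Require Import all_classical all_reals all_analysis.
From mathcomp Require Import ring lra zify.

Import Order.TTheory GRing.Theory Num.Theory.
Import numFieldNormedType.Exports.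

Local Open Scope classical_set_scope.
Local Open Scope ring_scope.

(** Rejecting a candidate [i] only helps if the best applicant lies beyond the
    window, so its value is at most [1 - m/N], against [m/N] for choosing, where
    [m = min(i+K, N)] applicants have been seen; hence the optimal threshold is
    at most 1 once [N <= 2K].  With threshold 0 the interviewer loses iff some
    candidate is not the best applicant.  For [N <= 2K] at most one applicant
    can be such a candidate, so the losing probability is the sum over [i] of
    [P(i candidate) - P(i best) = 1/min(i+K,N) - 1/N], a harmonic sum.
    Threshold 1 changes the outcome only if applicant 0 is a candidate, an
    event of probability [1/K <= 2/N]. *)

(** * Uniform permutations and the location of the minimum over a set of applicants *)

Section Counting.
Variables (R : realType) (N : nat).
Implicit Types (A : {set 'I_N}) (E F : pred 'S_N).

Lemma card_perm_pred E : #|E| = (\sum_s E s)%N.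
Proof.
by rewrite -sum1_card big_mkcond; apply: eq_bigr => s _; rewrite unfold_in; case: (E s).
Qed.

Lemma PrE E : Pr R E = (\sum_s (E s)%:R) / #|{: 'S_N}|%:R.
Proof. by rewrite /Pr card_perm_pred natr_sum. Qed.

Lemma card_Sn_gt0 : 0 < #|{: 'S_N}|%:R :> R.
Proof. by rewrite ltr0n; apply/card_gt0P; exists 1%g. Qed.

Lemma Pr_ge0 E : 0 <= Pr R E.
Proof. by rewrite divr_ge0. Qed.

Lemma le_Pr E F : (forall s, E s -> F s) -> Pr R E <= Pr R F.
Proof.
move=> EF; rewrite !PrE ler_pM2r ?invr_gt0 ?card_Sn_gt0 // ler_sum // => s _.
by have := EF s; case: (E s) => // ->.
Qed.

(** Common form of both basic events: [best i] takes for [A] all applicants, [candidate K i] those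
    seen when the window starts at [i]. *)
Definition min_at A (a : 'I_N) : pred 'S_N :=
  [pred s : 'S_N | [forall j in A, (s a <= s j)%N]].

Lemma sum_min_at A (s : 'S_N) : A != finset.set0 -> (\sum_(b in A) min_at A b s = 1)%N.
Proof.
case/set0Pn => a aA; case: (@arg_minnP _ a (mem A) (fun j => s j : nat) aA) => b bA bmin.
rewrite (bigD1 b) //= big1 ?addn0.
  by apply/eqP; rewrite eqb1; apply/forall_inP.
move=> c /andP[cA cb]; apply/eqP; rewrite eqb0; apply/negP => /forall_inP cmin.
case/eqP: cb; apply: (@perm_inj _ s); apply/val_inj/eqP => /=.
by rewrite eqn_leq cmin // bmin.
Qed.

Lemma min_at_tperm A (a b : 'I_N) (s : 'S_N) : a \in A -> b \in A ->
  min_at A b (tperm a b * s)%g = min_at A a s.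
Proof.
move=> aA bA; have tA j : j \in A -> tperm a b j \in A by case: tpermP => // ->.
apply/forall_inP/forall_inP => h j jA; last first.
  by rewrite !permM tpermR h // tA.
by have := h _ (tA _ jA); rewrite !permM tpermK tpermR.
Qed.

(** The transposition [tperm a b] exchanges the events for [a] and [b], so they are equally likely;
    as ranks are distinct, the events for the members of [A] partition the permutations. *)
Lemma Pr_min_at A (a : 'I_N) : a \in A -> Pr R (min_at A a) = #|A|%:R^-1.
Proof.
move=> aA; have A0 : A != finset.set0 by apply/set0Pn; exists a.
have card_min b : b \in A -> #|min_at A b| = #|min_at A a|.
  move=> bA; rewrite !card_perm_pred (reindex_inj (mulgI (tperm a b))) /=.
  by apply: eq_bigr => s _; rewrite min_at_tperm.
have /(congr1 (fun n => n%:R : R)) total : (#|A| * #|min_at A a| = #|{: 'S_N}|)%N.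
  transitivity (\sum_(b in A) #|min_at A b|)%N.
    by rewrite (eq_bigr _ card_min) sum_nat_const.
  rewrite (eq_bigr _ (fun b _ => card_perm_pred (min_at A b))) exchange_big /=.
  by rewrite (eq_bigr _ (fun s _ => sum_min_at A s A0)) sum1_card.
(* The product of the two cardinals is positive, so neither is zero and [field] may divide by
   both. *)
have := card_Sn_gt0; rewrite /Pr -total natrM => h.
have A_neq0 : #|A|%:R != 0 :> R.
  by apply: contraTneq h => ->; rewrite mul0r ltxx.
have m_neq0 : #|min_at A a|%:R != 0 :> R.
  by apply: contraTneq h => ->; rewrite mulr0 ltxx.
by field; rewrite A_neq0.
Qed.

End Counting.

(** * Candidates, and the bound on the optimal threshold *)

Section SlidingWindow.
Variables (R : realType) (N K : nat).
Implicit Types (i j : 'I_N) (s : 'S_N).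

Lemma best_unique i j s : best i s -> best j s -> i = j.
Proof.
by move=> /eqP bi /eqP bj; apply: (@perm_inj _ s); apply: val_inj; rewrite /= bi bj.
Qed.

Lemma best_exists s : (0 < N)%N -> exists i, best i s.
Proof.
by move=> N0; exists ((s^-1)%g (Ordinal N0)); rewrite /best /= permKV.
Qed.

Lemma best_candidate i s : best i s -> candidate K i s.
Proof. by move=> /eqP bi; apply/forallP => j; rewrite bi leq0n implybT. Qed.

(** If the best applicant had already been seen, it would outrank the candidate. *)
Lemma candidate_best i j s : candidate K i s -> best j s -> i != j -> (i + K <= j)%N.
Proof.
move=> /forallP /(_ j) ci bj; rewrite leqNgt; apply: contra => lt_j.
apply/eqP; apply: best_unique (bj).
by move: ci bj; rewrite lt_j /best /= => ci /eqP bj; rewrite -leqn0; move: ci; rewrite bj.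
Qed.

Lemma Pr_best i : Pr R (best i) = N%:R^-1.
Proof.
rewrite -[in RHS](card_ord N) -cardsT -(@Pr_min_at R N [set: 'I_N]%SET i) ?inE //.
congr (_%:R / _); apply: eq_card => s; rewrite !unfold_in /=.
have N0 : (0 < N)%N by apply: leq_ltn_trans (ltn_ord i).
apply/idP/forall_inP => [/eqP -> // | imin].
by have := imin ((s^-1)%g (Ordinal N0)); rewrite permKV /= inE leqn0; apply.
Qed.

Lemma Pr_candidate i : (0 < K)%N -> Pr R (candidate K i) = (minn (i + K) N)%:R^-1.
Proof.
move=> K0; set A := [set j : 'I_N | (j < i + K)%N]%SET.
have cardA : #|A| = minn (i + K) N.
  have le_mN : (minn (i + K) N <= N)%N by rewrite geq_minr.
  rewrite -[RHS]card_ord -(@card_imset _ _ (widen_ord le_mN)); last by move=> k l [] /val_inj.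
  apply: eq_card => j; rewrite inE; apply/idP/imsetP => [jK | [k _ ->] /=]; last first.
    by rewrite (leq_trans (ltn_ord k)) // geq_minl.
  have jm : (j < minn (i + K) N)%N by rewrite leq_min jK ltn_ord.
  by exists (Ordinal jm) => //; apply: val_inj.
have iA : i \in A by rewrite inE -[X in (X < _)%N]addn0 ltn_add2l.
rewrite -cardA -(@Pr_min_at R N A i iA).
congr (_%:R / _); apply: eq_card => s; rewrite !unfold_in /=.
by apply: eq_forallb => j; rewrite inE.
Qed.

(** Windows reached from [i.+1] on never contain [i], so a continuation wins only when [i] is not
    the best: inside [candidate K i], its winning event is disjoint from [best i]. *)
Lemma win_rejecting_le i : (0 < K)%N ->
  win_rejecting R K i <= (Pr R (candidate K i) - Pr R (best i)) / Pr R (candidate K i).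
Proof.
move=> K0; have best_le : Pr R (best i) <= Pr R (candidate K i).
  by apply: le_Pr => s; apply: best_candidate.
(* The maximum has default value 0, so the bound must also be shown nonnegative. *)
apply: bigmax_le => [|sigma /andP[win _]].
  by rewrite divr_ge0 ?subr_ge0 ?Pr_ge0.
rewrite ler_wpM2r ?invr_ge0 ?Pr_ge0 // lerBrDr !PrE -mulrDl.
rewrite ler_pM2r ?invr_gt0 ?card_Sn_gt0 // -big_split ler_sum // => s _.
rewrite /= -natrD ler_nat.
rewrite -[s \in wins_from _ _]/(wins_from _ _ s) -[s \in candidate _ _]/(candidate K i s).
case ci: (candidate K i s); last first.
  by rewrite andbF add0n; case bi: (best i s); rewrite // (best_candidate _ _ bi) in ci.
rewrite andbT; case bi: (best i s); last by rewrite addn0 leq_b1.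
rewrite addn1 ltnS leqn0 eqb0 /wins_from /=.
case cj: (chosen sigma i.+1 s) => [j|] //; apply/negP => bj.
have {bj} eij := best_unique _ _ _ bi bj.
(* The choice was made at some window start [k > i], and [in_window] then forces [k <= j],
   contradicting [j = i]. *)
have : Some j \in [seq sigma k s | k : 'I_N <- [seq k : 'I_N <- enum 'I_N | (i.+1 <= k)%N]].
  rewrite -mem_pmap; move: cj; rewrite /chosen.
  by case: pmap => //= x r [->]; rewrite mem_head.
case/mapP => k; rewrite mem_filter => /andP[ik _] /esym/eqP sk.
move/forallP: win => /(_ k)/forallP/(_ s)/forallP/(_ j); rewrite sk eij in ik *.
by move=> /andP[]; rewrite leqNgt ik.
Qed.

Lemma win_rejecting_lt i : (0 < K)%N -> (N < 2 * (i + K))%N ->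
  win_rejecting R K i < win_choosing R K i.
Proof.
move=> K0 lt_N; apply: le_lt_trans (win_rejecting_le i K0) _.
have iN := ltn_ord i.
have m0 : (0 < minn (i + K) N)%N by lia.
have cb : Pr R [predI best i & candidate K i] = Pr R (best i).
  congr (_%:R / _); apply: eq_card => s; rewrite !unfold_in /=.
  by rewrite andb_idr //; apply: best_candidate.
rewrite /win_choosing /cPr cb Pr_best Pr_candidate // ltr_pM2r ?invr_gt0 ?invr_gt0 ?ltr0n //.
(* With m = [minn (i + K) N], what remains is 1/m < 2/N, that is N < 2m. *)
rewrite ltrBlDr -mulr2n -[ltRHS]mulr_natr.
rewrite -[ltLHS]mul1r ltr_pdivrMr ?ltr0n // -mulrA ltr_pdivlMl ?ltr0n; last by lia.
by rewrite mulr1 -natrM ltr_nat; lia.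
Qed.

Lemma opt_threshold_le (d : nat) : (0 < K)%N -> (d < N)%N -> (N < 2 * (d + K))%N ->
  (opt_threshold R N K <= d)%N.
Proof.
move=> K0 dN lt_N; rewrite leqNgt; apply/negP => /(before_find (Ordinal dN)).
have -> : nth (Ordinal dN) (enum 'I_N) d = Ordinal dN.
  by apply: val_inj; rewrite /= nth_enum_ord.
by rewrite win_rejecting_lt.
Qed.

End SlidingWindow.

(** * Winning probabilities of thresholds 0 and 1 *)

Lemma ohead_filter_min (N : nat) (p : pred 'I_N) (r : seq 'I_N) (i j : 'I_N) :
  sorted ltn [seq val k | k <- r] -> ohead (seq.filter p r) = Some i ->
  j \in r -> p j -> (i <= j)%N.
Proof.
elim: r => //= x r IHr xr; case: ifP => [px [<-] | npx ri].
  rewrite inE => /predU1P[-> // | jr] _.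
  have /allP := order_path_min ltn_trans xr.
  by move=> /(_ j); rewrite map_f // => /(_ isT)/ltnW.
rewrite inE => /predU1P[-> | jr]; first by rewrite npx.
by apply: IHr => //; apply: path_sorted xr.
Qed.

Section Threshold.
Variables (R : realType) (N K : nat).
Implicit Types (i j : 'I_N) (s : 'S_N).

Lemma chosen_threshold0 s :
  chosen (threshold_rule N K 0) 0 s = ohead [seq i <- enum 'I_N | candidate K i s].
Proof.
rewrite /chosen filter_predT; congr ohead.
by elim: (enum _) => //= k r ->; rewrite !ffunE /=; case: ifP.
Qed.

(** The best applicant is itself a candidate, so some candidate is always chosen. A candidate that
    is not the best precedes the best one, so its presence keeps the first candidate from being the
    best. *)
Lemma threshold0_loses s : (0 < N)%N ->
  ~~ wins_from (threshold_rule N K 0) 0 s = [exists j, candidate K j s && ~~ best j s].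
Proof.
move=> N0; have [i bi] := best_exists _ s N0.
have ci := best_candidate _ K _ _ bi.
have i_in : i \in [seq i <- enum 'I_N | candidate K i s] by rewrite mem_filter ci mem_enum.
rewrite /wins_from /= chosen_threshold0.
case eqk: (ohead _) => [k|]; last by move: eqk i_in; case: [seq _ <- _ | _].
have : k \in [seq i <- enum 'I_N | candidate K i s].
  by move: eqk; case: [seq _ <- _ | _] => //= x r [->]; rewrite mem_head.
rewrite mem_filter => /andP[ck _].
apply/idP/existsP => [nbk | [j /andP[cj nbj]]]; first by exists k; rewrite ck.
have ij : i != j by apply: contraNneq nbj => <-.
apply: contra ij => bk; rewrite (best_unique _ _ _ _ bi bk).
have kj : (k <= j)%N.
  apply: ohead_filter_min eqk _ cj; last by rewrite mem_enum.
  by rewrite val_enum_ord iota_ltn_sorted.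
apply/negPn/negP => nkj; have : (j + K <= k)%N.
  by apply: candidate_best cj bk _; rewrite eq_sym.
move=> jk; case/eqP: nkj; apply: val_inj => /=; lia.
Qed.

Lemma threshold1_wins s : (forall j : 'I_N, j = 0 :> nat -> ~~ candidate K j s) ->
  wins_from (threshold_rule N K 1) 0 s = wins_from (threshold_rule N K 0) 0 s.
Proof.
move=> nc0; rewrite /wins_from /= /chosen.
congr (if ohead _ is Some j then best j s else false).
apply: eq_pmap => k; rewrite !ffunE /=.
by case: posnP => //= k0; rewrite (negPf (nc0 k k0)).
Qed.

(** The existential becomes a sum because at most one term is nonzero: two such candidates would
    each have been seen in the other's window, hence have equal ranks. *)
Lemma threshold0_loses_sum s : (0 < K <= N)%N -> (N <= 2 * K)%N ->
  (~~ wins_from (threshold_rule N K 0) 0 s =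
   \sum_(j : 'I_N) (candidate K j s && ~~ best j s) :> nat)%N.
Proof.
move=> /andP[K0 KN] N2K; have N0 : (0 < N)%N by lia.
rewrite threshold0_loses //; have [i bi] := best_exists _ s N0.
case: existsP => [[j cj] | nex]; last first.
  by rewrite big1 // => j _; apply/eqP; rewrite eqb0; apply/negP => cj; case: nex; exists j.
rewrite (bigD1 j) //= cj big1 // => k kj; apply/eqP; rewrite eqb0.
apply/negP => ck; case/eqP: kj.
(* The best applicant lies at [l + K] or later, and its index is below [N <= 2 * K]. *)
have early l : candidate K l s && ~~ best l s -> (l < K)%N.
  case/andP => cl nbl; have li : l != i by apply: contraNneq nbl => ->.
  by have := candidate_best _ _ _ _ _ cl bi li; have := ltn_ord i; lia.
have [jK kK] := (early j cj, early k ck).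
case/andP: cj ck => /forallP cj _ /andP[/forallP ck _].
apply: (@perm_inj _ s); apply/val_inj/eqP; rewrite /= eqn_leq.
by move: (cj k) (ck j); rewrite !ltn_addl //= => -> ->.
Qed.

Lemma Pr_threshold0 : (0 < K <= N)%N -> (N <= 2 * K)%N ->
  Pr R (wins_from (threshold_rule N K 0) 0) =
  1 - \sum_(K <= l < N) (l%:R^-1 - N%:R^-1).
Proof.
move=> /[dup] KN /andP[K0 KN'] N2K; have N0 : (0 < N)%N by lia.
set W := wins_from _ _.
have Pr_lose : 1 - Pr R W = \sum_(j : 'I_N) (Pr R (candidate K j) - Pr R (best j)).
  have h := card_Sn_gt0 R N.
  rewrite -[1](@divff _ #|{: 'S_N}|%:R) ?gt_eqF // PrE -mulrBl.
  under [RHS]eq_bigr do rewrite !PrE -mulrBl.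
  rewrite -mulr_suml; congr (_ / _); rewrite -sum1_card natr_sum -sumrB.
  under [RHS]eq_bigr do rewrite -sumrB.
  rewrite exchange_big; apply: eq_bigr => s _ /=.
  transitivity ((~~ W s)%:R : R); first by case: (W s); rewrite ?subrr ?subr0.
  rewrite (threshold0_loses_sum s KN N2K) natr_sum; apply: eq_bigr => j _.
  case bj: (best j s); last by rewrite andbT subr0.
  by rewrite (best_candidate _ K _ _ bj) subrr.
rewrite -[LHS](subKr 1) Pr_lose; congr (1 - _).
under eq_bigr do rewrite Pr_candidate // Pr_best.
rewrite -(big_mkord xpredT (fun j : nat => (minn (j + K) N)%:R^-1 - N%:R^-1)).
(* From [N - K] on everyone has been seen, so a candidate is the best and the terms vanish; the
   others are reindexed by l = j + K. *)
rewrite (@big_cat_nat _ _ _ (N - K)%N) ?leq_subr //= [X in _ + X]big_nat [X in _ + X]big1 ?addr0.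
  rewrite -[in RHS](add0n K) big_addn; apply: eq_big_nat => j jNK.
  by rewrite (minn_idPl _) //; lia.
by move=> j jN; rewrite (minn_idPr _) ?subrr //; lia.
Qed.

Lemma Pr_threshold_dist (d : nat) : (0 < K <= N)%N -> (d <= 1)%N ->
  `|Pr R (wins_from (threshold_rule N K d) 0) -
    Pr R (wins_from (threshold_rule N K 0) 0)| <= K%:R^-1.
Proof.
move=> /andP[K0 KN] d1; have N0 : (0 < N)%N by lia.
have [->|d0] := posnP d; first by rewrite subrr normr0 invr_ge0.
have -> : d = 1%N by lia.
have -> : K%:R^-1 = Pr R (candidate K (Ordinal N0)).
  by rewrite Pr_candidate // add0n (minn_idPl _).
have h := card_Sn_gt0 R N.
rewrite !PrE -mulrBl normrM normfV (gtr0_norm h) ler_pM2r ?invr_gt0 //.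
rewrite -sumrB (le_trans (ler_norm_sum _ _ _)) // ler_sum // => s _.
case c0: (candidate K (Ordinal N0) s).
  by do 2!case: wins_from; rewrite ?subrr ?subr0 ?sub0r ?normrN ?normr0 ?normr1.
rewrite threshold1_wins ?subrr ?normr0 // => j j0.
by rewrite (_ : j = Ordinal N0) ?c0 //; apply: val_inj.
Qed.

End Threshold.

(** * Harmonic sum estimate and the limit *)

Lemma harmonic_ln_bounds (R : realType) (K N : nat) : (0 < K <= N)%N ->
  - ln (K%:R / N%:R : R) <= \sum_(K <= l < N) (l%:R^-1 : R)
    <= K%:R^-1 - N%:R^-1 - ln (K%:R / N%:R : R).
Proof.
move=> /andP[K0 KN]; have N0 : (0 < N)%N by lia.
rewrite ln_div ?posrE ?ltr0n // opprB.
(* Both bounds come from ln (1 + x) <= x, at x = 1/l for the lower one and at x = -1/(l+1) for the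
   upper one; all differences then telescope. *)
have step l : (K <= l < N)%N ->
    ln (l.+1%:R : R) - ln l%:R <= l%:R^-1
    <= l%:R^-1 - l.+1%:R^-1 + (ln (l.+1%:R : R) - ln l%:R).
  move=> /andP[Kl _]; have l0 : 0 < l%:R :> R by rewrite ltr0n; lia.
  have l1 : 0 < l.+1%:R :> R by rewrite ltr0n.
  have e1 : ln (l.+1%:R : R) - ln l%:R = ln (1 + l%:R^-1).
    by rewrite -ln_div ?posrE // -natr1 mulrDl mul1r divff ?gt_eqF.
  have e2 : ln (l.+1%:R : R) - ln l%:R = - ln (1 - l.+1%:R^-1).
    have -> : 1 - l.+1%:R^-1 = l%:R / l.+1%:R :> R.
      by rewrite -natr1; field; rewrite natr1 pnatr_eq0.
    by rewrite ln_div ?posrE // opprB.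
  apply/andP; split.
    by rewrite e1 le_ln1Dx // (lt_trans (ltrN10 _)) // invr_gt0.
  rewrite -addrA lerDl addrC subr_ge0 e2 lerNr le_ln1Dx // ltrN2.
  by rewrite invf_lt1 // ltr1n ltnS; lia.
rewrite -(telescope_sumr (fun l => ln (l%:R : R)) KN); apply/andP; split.
  by apply: ler_sum_nat => l /step /andP[].
rewrite -opprB -(telescope_sumr (fun l => l%:R^-1 : R) KN) -sumrN -big_split /=.
by apply: ler_sum_nat => l /step /andP[_]; rewrite opprB.
Qed.

(** Two errors of at most 1/K each, from replacing the optimal threshold by 0 and the harmonic sum
    by a logarithm. Since 1/K <= 4/(N+1), the constant is 8; [N.+1] matches the terms of
    [harmonic]. *)
Lemma opt_win_dist (R : realType) (N K : nat) : (0 < N)%N -> (N <= 2 * K)%N -> (K <= N)%N ->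
  `|opt_win R N K - (2 - K%:R / N%:R + ln (K%:R / N%:R))| <= 8 * N.+1%:R^-1.
Proof.
move=> N0 N2K KN; have KN0 : (0 < K <= N)%N by lia.
have d1 : (opt_threshold R N K <= 1)%N.
  (* For [N = 1] no applicant has position 1, so the bound is taken at position 0. *)
  have [N1 | N1] := leqP N 1.
    by apply: leq_trans (@opt_threshold_le R N K 0 _ _ _) _; lia.
  by apply: opt_threshold_le; lia.
have dist := @Pr_threshold_dist R N K _ KN0 d1.
have /andP[lo hi] := @harmonic_ln_bounds R K N KN0.
have k0 : 0 < K%:R :> R by rewrite ltr0n; lia.
have n0 : 0 < N%:R :> R by rewrite ltr0n.
have K8 : K%:R^-1 <= 4 * N.+1%:R^-1 :> R.
  rewrite -[leLHS]mul1r ler_pdivrMr // mulrAC ler_pdivlMr ?ltr0n // mul1r -natrM ler_nat.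
  by lia.
have sumE : \sum_(K <= l < N) (l%:R^-1 - N%:R^-1 : R) =
    \sum_(K <= l < N) (l%:R^-1 : R) - (1 - K%:R / N%:R).
  rewrite sumrB sumr_const_nat -[_ *+ _]mulr_natl natrB // mulrBl divff //.
  by rewrite gt_eqF.
have ninv : 0 < N%:R^-1 :> R by rewrite invr_gt0.
move: dist; rewrite /opt_win Pr_threshold0 // sumE !ler_norml => {d1 sumE k0 n0}; move: lo hi K8 ninv.
(* Once the nonlinear terms are abstracted, the estimate is linear in them. *)
move: (N%:R^-1 : R) (K%:R^-1 : R) (N.+1%:R^-1 : R) (K%:R / N%:R) (Pr _ _)
  (\sum_(K <= l < N) _) (ln _) => x y z q p S L.
move=> lo hi K8 ninv /andP[dlo dhi]; apply/andP; split; lra.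
Qed.

Theorem theorem3p4 (R : realType) :
  [/\ (forall N K : nat, (0 < K <= N)%N -> (N < 2 * K)%N ->
         opt_threshold R N K = 0%N),
      (forall N K : nat, (0 < K <= N)%N -> (2 * K = N)%N ->
         opt_threshold R N K = 0%N \/ opt_threshold R N K = 1%N)
    & (forall K : nat -> nat,
         (forall N : nat, (0 < N)%N -> (N <= 2 * K N)%N /\ (K N <= N)%N) ->
         (fun N : nat =>
            opt_win R N (K N)
            - (2 - (K N)%:R / N%:R + ln ((K N)%:R / N%:R))) @ \oo --> (0 : R))].
Proof.
split=> [N K /andP[K0 KN] N2K | N K /andP[K0 KN] N2K | K KP].
- by apply/eqP; rewrite -leqn0; apply: opt_threshold_le; lia.
- have : (opt_threshold R N K <= 1)%N by apply: opt_threshold_le; lia.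
  by case: opt_threshold => [|[]]; [left | right |].
apply: norm_cvg0; apply: (@squeeze_cvgr _ _ _ _ (cst 0) (fun N => 8 * harmonic N)).
(* The hypothesis on [K] covers only positive [N], so the squeeze is claimed eventually. *)
- near=> N; rewrite normr_ge0 /=.
  have N0 : (0 < N)%N by near: N; exact: nbhs_infty_gt.
  by have [N2K KN] := KP N N0; apply: opt_win_dist.
- exact: cvg_cst.
- by rewrite -(mulr0 8); apply: cvgMr; exact: cvg_harmonic.
Unshelve. all: by end_near. Qed.
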